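(* For every set of formulas $\Gamma$, formula $\varphi$, and $k\in\{1,2\}$: $\Gamma\vdash_k\varphi \Rightarrow \Gamma\vDash_k\varphi$.
   Context: Formulas are built from a countable set $PL$ of propositional letters and $\bot$ using $\land,\lor,\to$; $\neg\alpha:=\alpha\to\bot$, $\top:=\bot\to\bot$. For a frame $\mathfrak F=\langle W,R\rangle$, $X\subseteq W$: $\Box_{\mathfrak F}X=\{w\mid\forall v(wRv\Rightarrow v\in X)\}$, $\Diamond_{\mathfrak F}X=W\setminus\Box_{\mathfrak F}(W\setminus X)$, $\Diamond^{-1}_{\mathfrak F}X=\{w\mid\exists x\in X,\ xRw\}$; $FP_{\mathfrak F}=\{\Box_{\mathfrak F}X\mid X\subseteq W\}$. A $\Box\Diamond^{-1}$-model is a Kripke model with $V(p)\in FP_{\mathfrak F}$ for all $p$. Truth sets: $\|p\|=V(p)$, $\|\bot\|=\Box_{\mathfrak F}\emptyset$, $\|\alpha\land\beta\|=\|\alpha\|\cap\|\beta\|$, $\|\alpha\to\beta\|=\Box_{\mathfrak F}((W\setminus\|\alpha\|)\cup\|\beta\|)$, $\|\alpha\lor\beta\|=\Box_{\mathfrak F}\Diamond^{-1}_{\mathfrak F}(\|\alpha\|\cup\|\beta\|)$. A frame is pseudo-reflexive iff every $w\in\Box_{\mathfrak F}\emptyset\cup\Diamond_{\mathfrak F}\Box_{\mathfrak F}\Diamond^{-1}_{\mathfrak F}\{w\}$, and pseudo-symmetric iff every $w\in\Box_{\mathfrak F}\Diamond_{\mathfrak F}\Box_{\mathfrak F}\Diamond^{-1}_{\mathfrak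 F}\{w\}$. $\mathcal D_1$ = pseudo-reflexive pseudo-symmetric $\Box\Diamond^{-1}$-models; $\mathcal D_2$ = reflexive pseudo-symmetric $\Box\Diamond^{-1}$-models; $\Gamma\vDash_k\varphi$ iff for every $\mathfrak M\in\mathcal D_k$ and $w$, $\mathfrak M,w\vDash\Gamma$ implies $\mathfrak M,w\vDash\varphi$. Syntax: relations $\vdash\subseteq Form\times Form$, extended to sets by $\Gamma\vdash\alpha$ iff $\bigwedge\Gamma_0\vdash\alpha$ for some finite $\Gamma_0\subseteq\Gamma$ ($\bigwedge\emptyset=\top$); ''$\vdash\alpha$'' means $\chi\vdash\alpha$ for all $\chi$. Basic rules: (A) $\alpha\vdash\alpha$; (Cut) $\alpha\vdash\beta,\beta\vdash\gamma\Rightarrow\alpha\vdash\gamma$; ($\bot$) $\bot\vdash\alpha$; ($\land$R) $\chi\vdash\alpha,\chi\vdash\beta\Rightarrow\chi\vdash\alpha\land\beta$; ($\land$L) $\alpha\land\beta\vdash\alpha$, $\alpha\land\beta\vdash\beta$; ($\lor$R) $\alpha\vdash\alpha\lor\beta$, $\beta\vdash\alpha\lor\beta$; ($\lor$L) $\alpha\vdash\chi,\beta\vdash\chi\Rightarrow\alpha\lor\beta\vdash\chi$; (DT$_0$) $\alpha\vdash\beta\Rightarrow\ \vdash\alpha\to\beta$; ($\to\land$) $(\alpha\to\beta)\land(\alpha\to\gamma)\vdash\alpha\to\beta\land\gamma$; ($\to$tr) $(\alpha\to\beta)\land(\beta\to\gamma)\vdash\alpha\to\gamma$; ($\to$-$\lor$.s)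 for $n\ge1$, $\bigvee_j(\alpha_j\to\beta_j)\land\bigwedge_j(\psi_j\land\beta_j\to\chi)\vdash\bigwedge_j(\psi_j\land\alpha_j)\to\chi$. Further rules: (Abs) $\alpha\land\neg\alpha\vdash\bot$; ($\neg\neg$I) $\alpha\vdash\neg\neg\alpha$; (Refl$_1$) if $\psi_j\land\beta_j\vdash\chi$ for all $1\le j\le n$ then $\bigwedge_j(\psi_j\land\alpha_j)\land\bigvee_j(\alpha_j\to\beta_j)\vdash\chi$; (Refl$_2$) $\bigwedge_j(\psi_j\land\beta_j\to\chi)\vdash\bigwedge_j(\psi_j\land\alpha_j)\land\bigvee_j(\alpha_j\to\beta_j)\to\chi$. i-formulas: expressions $\Delta\sqsupset\Theta$ with $\Delta,\Theta$ non-empty finite sets of formulas. $\Vdash_1\subseteq\wp(Form^i)\times Form^i$ is the least relation satisfying: (A) $\Gamma^i\cup\{\alpha^i\}\Vdash\alpha^i$; (Cut) $\Gamma^i\Vdash\alpha^i$ and $\Phi^i\cup\{\alpha^i\}\Vdash\beta^i$ imply $\Gamma^i\cup\Phi^i\Vdash\beta^i$; (i-A) $\Delta\cap\Theta\neq\emptyset\Rightarrow\ \Vdash\Delta\sqsupset\Theta$; (i-Cut) $\{\Delta_1\sqsupset\Theta_1\cup\{\varphi\},\Delta_2\cup\{\varphi\}\sqsupset\Theta_2\}\Vdash\Delta_1\cup\Delta_2\sqsupset\Theta_1\cup\Theta_2$; (i-$\land$L) $\Vdash\{\varphi\land\psi\}\sqsupset\{\varphi\}$ and $\Vdash\{\varphi\land\psi\}\sqsupset\{\psi\}$;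 (i-$\land$R) $\Vdash\{\varphi,\psi\}\sqsupset\{\varphi\land\psi\}$. For a formula $\gamma$, $\Vdash^\gamma_2$ is the least such relation also satisfying ($\gamma$-Refl) $\Vdash\{\varphi_1,\dots,\varphi_n,\bigvee_j(\varphi_j\to\psi_j)\lor\gamma\}\sqsupset\{\psi_1,\dots,\psi_n\}$. Let $i_\gamma(\Gamma)=\{\{\varphi_1,\dots,\varphi_n\}\sqsupset\{\psi_1,\dots,\psi_n\}\mid\bigvee_j(\varphi_j\to\psi_j)\lor\gamma\in\Gamma\}$ and $Th_{\vdash}(\alpha)=\{\varphi\mid\alpha\vdash\varphi\}$. $\vdash_1$ is the smallest $\vdash$ satisfying the basic rules, (Abs), ($\neg\neg$I) and (Prop$_1$): $i_\gamma(Th_\vdash(\alpha))\Vdash_1\{\top\}\sqsupset\{\bot\}\Rightarrow\alpha\vdash\gamma$. $\vdash_2$ is the smallest $\vdash$ satisfying the basic rules, ($\neg\neg$I), (Refl$_1$), (Refl$_2$) and (Prop$_2$): $i_\gamma(Th_\vdash(\alpha))\Vdash^\gamma_2\{\top\}\sqsupset\{\bot\}\Rightarrow\alpha\vdash\gamma$. *)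

(* Defs.v *)
From HB Require Import structures.
From mathcomp Require Import all_boot finmap.
From mathcomp Require Import boolp classical_sets.

Set Implicit Arguments.
Unset Strict Implicit.
Unset Printing Implicit Defensive.

Local Open Scope classical_set_scope.

Inductive form (PL : Type) : Type :=
| Var of PL
| Bot
| And of form PL & form PL
| Or of form PL & form PL
| Imp of form PL & form PL.

Arguments Bot {PL}.

HB.instance Definition _ (PL : Type) := gen_eqMixin (form PL).
HB.instance Definition _ (PL : Type) := gen_choiceMixin (form PL).

Declare Scope form_scope.
Delimit Scope form_scope with F.
Bind Scope form_scope with form.

Notation "a ∧ b" := (And a b) (at level 40, left associativity) : form_scope.
Notation "a ∨ b" := (Or a b) (at level 50, left associativity) : form_scope.
Notation "a ⇒ b" := (Imp a b) (at level 55, right associativity) : form_scope.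
Notation "⊥" := Bot (at level 0) : form_scope.

Definition Neg (PL : Type) (a : form PL) : form PL := (a ⇒ ⊥)%F.
Definition Top {PL : Type} : form PL := (⊥ ⇒ ⊥)%F.

Notation "¬ a" := (Neg a) (at level 35, right associativity) : form_scope.
Notation "⊤" := Top (at level 0) : form_scope.

Section Iterated.
Variable PL : Type.
Implicit Types s : seq (form PL).

(* A one-element conjunction or disjunction is the formula itself: no
   trailing ⊤ or ⊥ is added. *)
Fixpoint conj_seq s : form PL :=
  match s with
  | [::] => ⊤%F
  | [:: a] => a
  | a :: s' => (a ∧ conj_seq s')%F
  end.

Fixpoint disj_seq s : form PL :=
  match s with
  | [::] => ⊥%F
  | [:: a] => a
  | a :: s' => (a ∨ disj_seq s')%F
  end.

Definition conj_fam n (f : 'I_n -> form PL) : form PL :=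
  conj_seq [seq f j | j <- enum 'I_n].
Definition disj_fam n (f : 'I_n -> form PL) : form PL :=
  disj_seq [seq f j | j <- enum 'I_n].

End Iterated.

Notation "⋀_ ( j < n ) E" := (conj_fam (fun j : 'I_n => E%F))
  (at level 36, E at level 36, j, n at level 50) : form_scope.
Notation "⋁_ ( j < n ) E" := (disj_fam (fun j : 'I_n => E%F))
  (at level 36, E at level 36, j, n at level 50) : form_scope.

(* The empty universe of worlds is not excluded; consequence quantifies over
   worlds, so the empty frame imposes no condition. *)
Record frame : Type := Frame {
  world :> Type;
  acc : world -> world -> Prop
}.

Section FrameOperators.
Variable F : frame.
Implicit Types X : set F.

Definition Box X : set F := [set w | forall v, acc w v -> X v].
Definition Diamond X : set F := ~` Box (~` X).
Definition DiamondInv X : set F := [set w | exists2 x, X x & acc x w].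
Definition FP : set (set F) := [set Box X | X in [set: set F]].

Definition reflexive_frame : Prop := forall w : F, acc w w.
Definition pseudo_reflexive : Prop := forall w : F,
  (Box set0 `|` Diamond (Box (DiamondInv [set w]))) w.
Definition pseudo_symmetric : Prop := forall w : F,
  Box (Diamond (Box (DiamondInv [set w]))) w.

End FrameOperators.

Record model (PL : Type) : Type := Model {
  frame_of :> frame;
  valu : PL -> set frame_of
}.

Arguments valu {PL} m p _ : rename.

Definition box_diamondinv_model (PL : Type) (M : model PL) : Prop :=
  forall p : PL, FP (valu M p).

Section Truth.
Variables (PL : Type) (M : model PL).

Fixpoint truth (a : form PL) : set M :=
  match a with
  | Var p => valu M p
  | Bot => Box set0
  | And a b => truth a `&` truth b
  | Or a b => Box (DiamondInv (truth a `|` truth b))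
  | Imp a b => Box (~` truth a `|` truth b)
  end.

End Truth.

Arguments truth {PL} M a _.

Variant logic : Type := One | Two.

Definition model_class (PL : Type) (k : logic) : set (model PL) :=
  match k with
  | One => [set M : model PL | [/\ pseudo_reflexive M, pseudo_symmetric M &
                                   box_diamondinv_model M]]
  | Two => [set M : model PL | [/\ reflexive_frame M, pseudo_symmetric M &
                                   box_diamondinv_model M]]
  end.

Definition entails (PL : Type) (k : logic) (G : set (form PL)) (f : form PL) :
    Prop :=
  forall M : model PL, model_class k M ->
  forall w : M, (forall g, G g -> truth M g w) -> truth M f w.

Record iform (PL : Type) : Type := IForm {
  iante : {fset form PL};
  isucc : {fset form PL};
  iante_neq0 : iante != fset0;
  isucc_neq0 : isucc != fset0
}.

(* Arguments named h* are the (proof-irrelevant) non-emptiness proofs needed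
   for an expression to be an i-formula. In i_cut, T1 and D2 may be empty. *)
Notation "D ⊐ T '[' h , h' ']'" := (@IForm _ D%fset T%fset h h')
  (at level 70, T at level 69, h at level 69, h' at level 69).

(* The least relation closed under (A), (Cut), (i-A), (i-Cut), (i-∧L), (i-∧R)
   together with the extra premise-free i-formulas in Ax. *)
Inductive iderives (PL : Type) (Ax : set (iform PL)) :
    set (iform PL) -> iform PL -> Prop :=
| i_ass G a : iderives Ax (G `|` [set a]) a
| i_trans G H a b :
    iderives Ax G a -> iderives Ax (H `|` [set a]) b ->
    iderives Ax (G `|` H) b
| i_A (D T : {fset form PL}) h h' :
    (D `&` T)%fset != fset0 -> iderives Ax set0 (D ⊐ T [h, h'])
| i_cut (D1 D2 T1 T2 : {fset form PL}) (f : form PL) h1 h1' h2 h2' h h' :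
    iderives Ax
      [set D1 ⊐ T1 `|` [fset f] [h1, h1']; D2 `|` [fset f] ⊐ T2 [h2, h2']]
      (D1 `|` D2 ⊐ T1 `|` T2 [h, h'])
| i_andL1 (f g : form PL) h h' :
    iderives Ax set0 ([fset (f ∧ g)%F] ⊐ [fset f] [h, h'])
| i_andL2 (f g : form PL) h h' :
    iderives Ax set0 ([fset (f ∧ g)%F] ⊐ [fset g] [h, h'])
| i_andR (f g : form PL) h h' :
    iderives Ax set0 ([fset f; g] ⊐ [fset (f ∧ g)%F] [h, h'])
| i_ax a : Ax a -> iderives Ax set0 a.

Definition gamma_refl (PL : Type) (c : form PL) : set (iform PL) :=
  [set x | exists n (f g : 'I_n.+1 -> form PL),
    iante x = ([fset f j | j in 'I_n.+1] `|`
               [fset ((⋁_(j < n.+1) (f j ⇒ g j)) ∨ c)%F])%fset /\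
    isucc x = [fset g j | j in 'I_n.+1]%fset].

Definition iderives_k (PL : Type) (k : logic) (c : form PL) :
    set (iform PL) -> iform PL -> Prop :=
  match k with
  | One => iderives set0
  | Two => iderives (gamma_refl c)
  end.

Definition i_set (PL : Type) (c : form PL) (G : set (form PL)) :
    set (iform PL) :=
  [set x | exists n (f g : 'I_n.+1 -> form PL),
    [/\ iante x = [fset f j | j in 'I_n.+1]%fset,
        isucc x = [fset g j | j in 'I_n.+1]%fset &
        G ((⋁_(j < n.+1) (f j ⇒ g j)) ∨ c)%F]].

Definition Th (PL : Type) (D : form PL -> form PL -> Prop) (a : form PL) :
  set (form PL) := [set f | D a f].

Lemma fset1_neq0 (K : choiceType) (x : K) : [fset x]%fset != fset0.
Proof. by apply/fset0Pn; exists x; rewrite in_fset1. Qed.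

Definition itop_bot (PL : Type) : iform PL :=
  [fset ⊤%F] ⊐ [fset ⊥%F] [fset1_neq0 _, fset1_neq0 _].

Section Rules.
Variables (PL : Type) (D : form PL -> form PL -> Prop).
Local Notation "a ⊢ b" := (D a%F b%F) (at level 70).
Implicit Types a b c x : form PL.

Record basic_rules : Prop := BasicRules {
  r_A : forall a, a ⊢ a;
  r_Cut : forall a b c, a ⊢ b -> b ⊢ c -> a ⊢ c;
  r_Bot : forall a, ⊥ ⊢ a;
  r_AndR : forall x a b, x ⊢ a -> x ⊢ b -> x ⊢ a ∧ b;
  r_AndL1 : forall a b, a ∧ b ⊢ a;
  r_AndL2 : forall a b, a ∧ b ⊢ b;
  r_OrR1 : forall a b, a ⊢ a ∨ b;
  r_OrR2 : forall a b, b ⊢ a ∨ b;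
  r_OrL : forall a b x, a ⊢ x -> b ⊢ x -> a ∨ b ⊢ x;
  r_DT0 : forall a b, a ⊢ b -> forall x, x ⊢ a ⇒ b;
  r_ImpAnd : forall a b c, (a ⇒ b) ∧ (a ⇒ c) ⊢ a ⇒ b ∧ c;
  r_ImpTr : forall a b c, (a ⇒ b) ∧ (b ⇒ c) ⊢ a ⇒ c;
  r_ImpOrS : forall n (p a b : 'I_n.+1 -> form PL) x,
    (⋁_(j < n.+1) (a j ⇒ b j)) ∧ (⋀_(j < n.+1) (p j ∧ b j ⇒ x))
      ⊢ (⋀_(j < n.+1) (p j ∧ a j)) ⇒ x
}.

Definition r_Abs : Prop := forall a, a ∧ ¬ a ⊢ ⊥.
Definition r_NegNegI : Prop := forall a, a ⊢ ¬ ¬ a.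

Definition r_Refl1 : Prop := forall n (p a b : 'I_n.+1 -> form PL) x,
  (forall j, p j ∧ b j ⊢ x) ->
  (⋀_(j < n.+1) (p j ∧ a j)) ∧ (⋁_(j < n.+1) (a j ⇒ b j)) ⊢ x.

Definition r_Refl2 : Prop := forall n (p a b : 'I_n.+1 -> form PL) x,
  ⋀_(j < n.+1) (p j ∧ b j ⇒ x)
    ⊢ (⋀_(j < n.+1) (p j ∧ a j)) ∧ (⋁_(j < n.+1) (a j ⇒ b j)) ⇒ x.

Definition r_Prop (k : logic) : Prop := forall a c,
  iderives_k k c (i_set c (Th D a)) (itop_bot PL) -> a ⊢ c.

Definition satisfies_rules (k : logic) : Prop :=
  match k with
  | One => [/\ basic_rules, r_Abs, r_NegNegI & r_Prop One]
  | Two => [/\ basic_rules, r_NegNegI, r_Refl1, r_Refl2 & r_Prop Two]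
  end.

End Rules.

(* The smallest relation satisfying the rules, as the intersection of all of
   them; vdash_satisfies_rules shows that it does satisfy them. It is not an
   Inductive because (Prop) is monotone but not strictly positive. *)
Definition vdash (PL : Type) (k : logic) (a b : form PL) : Prop :=
  forall D : form PL -> form PL -> Prop, satisfies_rules D k -> D a b.

Definition vdash_set (PL : Type) (k : logic) (G : set (form PL))
    (f : form PL) : Prop :=
  exists2 G0 : {fset form PL},
    (forall g, g \in G0 -> G g) & vdash k (conj_seq (enum_fset G0)) f.

Lemma iderives_weak (PL : Type) (Ax : set (iform PL)) G H a :
  G `<=` H -> iderives Ax G a -> iderives Ax H a.
Proof.
move=> GH Ga; rewrite -(setUidr GH).
exact: i_trans Ga (i_ass _ _ _).
Qed.

Lemma vdash_satisfies_rules (PL : Type) (k : logic) :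
  satisfies_rules (@vdash PL k) k.
Proof.
have basic : basic_rules (@vdash PL k).
  have B D : satisfies_rules D k -> @basic_rules PL D by case: (k) => -[].
  split.
  - by move=> a D /B; move/r_A; apply.
  - by move=> a b c ab bc D HD; apply: (r_Cut (B D HD) (ab D HD) (bc D HD)).
  - by move=> a D /B; move/r_Bot; apply.
  - by move=> x a b xa xb D HD; apply: (r_AndR (B D HD) (xa D HD) (xb D HD)).
  - by move=> a b D /B; move/r_AndL1; apply.
  - by move=> a b D /B; move/r_AndL2; apply.
  - by move=> a b D /B; move/r_OrR1; apply.
  - by move=> a b D /B; move/r_OrR2; apply.
  - by move=> a b x ax bx D HD; apply: (r_OrL (B D HD) (ax D HD) (bx D HD)).
  - by move=> a b ab x D HD; apply: (r_DT0 (B D HD) (ab D HD)).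
  - by move=> a b c D /B; move/r_ImpAnd; apply.
  - by move=> a b c D /B; move/r_ImpTr; apply.
  - by move=> n p a b x D /B; move/r_ImpOrS; apply.
have prop : r_Prop (@vdash PL k) k.
  move=> a c Hac D HD.
  have P : r_Prop D k by move: HD; case: (k) => -[].
  apply: P.
  have sub : i_set c (Th (@vdash PL k) a) `<=` i_set c (Th D a).
    by move=> x [n [f [g [hf hg h]]]]; exists n, f, g; split=> //; exact: h.
  by case: (k) sub Hac => /= sub; exact: iderives_weak.
case: k basic prop => basic prop; split=> //.
- by move=> a D HD; case: (HD).
- by move=> a D HD; case: (HD).
- by move=> a D HD; case: (HD).
- move=> n p a b x H D HD; case: (HD) => _ _ R _ _.
  by apply: R => j; exact: H.
- by move=> n p a b x D HD; case: (HD).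
Qed.

(* Main.v *)
Require Import Defs.
From mathcomp Require Import all_boot finmap boolp classical_sets.

(** Truth sets are fixed points of the closure operator [Box ∘ DiamondInv],
    which makes [∨] the join of fixed points.  If [w] satisfies [a] but not [c],
    some successor [v] of [w] has no predecessor satisfying [c].  At such a [v]
    the i-formulas of [i_set c (Th _ a)] hold when read classically, and so does
    everything they i-derive; since pseudo-symmetry forbids [v] to be a dead
    end, [⊤ ⊐ ⊥] fails at [v], whence (Prop). *)

Set Implicit Arguments.
Unset Strict Implicit.
Unset Printing Implicit Defensive.

Local Open Scope classical_set_scope.

(** * Fixed points of [Box ∘ DiamondInv] on a frame *)

Section Frames.
Variable F : frame.
Implicit Types (w v u : F) (X Y : set F).

(** The converse inclusion holds for every [X], so this says that [X] is a fixed point. *)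
Definition box_closed X : Prop := Box (DiamondInv X) `<=` X.

(** [DiamondInv] is left adjoint to [Box], so [DiamondInv (Box X)] lies in [X]. *)
Lemma box_box_closed X : box_closed (Box X).
Proof. by move=> w Xw v /Xw[u]; apply. Qed.

Lemma box_closedI X Y : box_closed X -> box_closed Y -> box_closed (X `&` Y).
Proof.
move=> cX cY w XYw; split; [apply: cX|apply: cY];
  by move=> v /XYw[u [Xu Yu] uv]; exists u.
Qed.

Lemma FP_box_closed X : FP X -> box_closed X.
Proof. by case=> Y _ <-; exact: box_box_closed. Qed.

Lemma box_DiamondInv_sub X Y :
  box_closed Y -> X `<=` Y -> Box (DiamondInv X) `<=` Y.
Proof. by move=> cY XY w Xw; apply: cY => v /Xw[u /XY]; exists u. Qed.

(** [Box (DiamondInv [set w])] is the least fixed point containing [w], hence lies in [X]. Through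
    this, pseudo-reflexivity and pseudo-symmetry yield successors satisfying a given formula. *)
Lemma diamond_box_DiamondInv1 X w v :
  box_closed X -> X w -> Diamond (Box (DiamondInv [set w])) v ->
  exists2 u, acc v u & X u.
Proof.
move=> cX Xw Hv; apply: contrapT => nu; apply: Hv => u vu Hu.
by apply: nu; exists u => //; apply: box_DiamondInv_sub Hu => // _ ->.
Qed.

(** A dead end lies in no [Diamond X], whereas pseudo-symmetry at [w] puts [v] in one. *)
Lemma successor_not_dead w v :
  pseudo_symmetric F -> acc w v -> ~ Box set0 v.
Proof. by move=> ps wv dv; apply: (ps w v wv) => u /dv. Qed.

End Frames.

(** * Truth sets as fixed points; iterated connectives *)

Section Soundness.
Variables (PL : Type) (M : model PL).
Hypothesis M_FP : box_diamondinv_model M.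
Implicit Types (w v : M) (a b c : form PL) (s : seq (form PL)) (x : iform PL).

Lemma truth_box_closed a : box_closed (truth M a).
Proof.
elim: a => [p||a IHa b IHb|a _ b _|a _ b _] /=; try exact: box_box_closed.
- by apply: FP_box_closed; exact: M_FP.
- exact: box_closedI.
Qed.

Lemma truth_Bot_sub a : truth M Bot `<=` truth M a.
Proof. by move=> w dw; apply: truth_box_closed => v /dw. Qed.

Lemma truth_Top w : truth M Top w.
Proof. by move=> v _; have [|] := EM (truth M Bot v); [right|left]. Qed.

Lemma truth_OrL a b c :
  truth M a `<=` truth M c -> truth M b `<=` truth M c ->
  truth M (Or a b) `<=` truth M c.
Proof.
move=> ac bc; apply: box_DiamondInv_sub; first exact: truth_box_closed.
by move=> w [/ac|/bc].
Qed.

Lemma truth_conj_seq s w :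
  truth M (conj_seq s) w <-> (forall a, a \in s -> truth M a w).
Proof.
elim: s => [|a [|b s] IH]; first by split=> // _; exact: truth_Top.
  by split=> [aw c|]; [rewrite inE => /eqP->|apply; rewrite mem_head].
split=> [[aw /IH sw] c|H].
  by rewrite inE => /orP[/eqP->|/sw].
split; first by apply: H; rewrite mem_head.
by apply/IH => c cs; apply: H; rewrite inE cs orbT.
Qed.

(** [X] ranges over all fixed points because it will be a [Box] that need not be the truth set of a
    formula. *)
Lemma truth_disj_seq s (X : set M) :
  box_closed X -> (forall a, a \in s -> truth M a `<=` X) ->
  truth M (disj_seq s) `<=` X.
Proof.
move=> cX; elim: s => [_ w dw|a [|b s] IH H]; first by apply: cX => v /dw.
  by apply: H; rewrite mem_head.
apply: box_DiamondInv_sub => // w [aw|].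
  by apply: H aw; rewrite mem_head.
by apply: IH => c cs; apply: H; rewrite inE cs orbT.
Qed.

Lemma truth_conj_fam n (h : 'I_n -> form PL) w :
  truth M (conj_fam h) w <-> (forall j, truth M (h j) w).
Proof.
split=> [/truth_conj_seq H j|H].
  by apply: H; rewrite map_f // mem_enum.
by apply/truth_conj_seq => _ /mapP[j _ ->].
Qed.

Lemma truth_disj_fam_imp n (a b : 'I_n -> form PL) w v :
  truth M (disj_fam (fun j => Imp (a j) (b j))) w -> acc w v ->
  (forall j, truth M (a j) v) -> exists j, truth M (b j) v.
Proof.
(* [X] is where some [Imp (a j) (b j)] holds as a classical implication. Each disjunct lies in the
   fixed point [Box X], hence so does the disjunction. *)
move=> Hw wv av; pose X := [set u : M | exists j, truth M (b j) u \/ ~ truth M (a j) u].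
have /(_ w Hw v wv) [j []] : truth M (disj_fam (fun j => Imp (a j) (b j))) `<=` Box X.
  apply: truth_disj_seq => [|_ /mapP[j _ ->] u /= Hu t /Hu]; first exact: box_box_closed.
  by case=> ?; exists j; [right|left].
- by exists j.
- by move/(_ (av j)).
Qed.

(** The disjunction at [w] only yields some predecessor [u] of [v], possibly other than [w], where
    one side holds. As [c] fails at all predecessors of [v], the implications are available at
    [u]. *)
Lemma truth_disj_fam_imp_or n (a b : 'I_n -> form PL) c w v :
  truth M (Or (disj_fam (fun j => Imp (a j) (b j))) c) w -> acc w v ->
  ~ DiamondInv (truth M c) v ->
  (forall j, truth M (a j) v) -> exists j, truth M (b j) v.
Proof.
move=> Hw wv ncv; have [u [Hu uv|cu uv]] := Hw v wv.
  exact: truth_disj_fam_imp Hu uv.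
by case: ncv; exists u.
Qed.

(** * Classical reading of i-formulas at a single world *)

Definition itruth v x : Prop :=
  (forall a, a \in iante x -> truth M a v) ->
  exists2 a, a \in isucc x & truth M a v.

(** One fixed world suffices: apart from [Ax], the rules mention no connective but [And], whose
    truth set is an intersection. *)
Lemma iderives_itruth v (Ax H : set (iform PL)) x :
  iderives Ax H x -> (forall y, Ax y -> itruth v y) ->
  (forall y, H y -> itruth v y) -> itruth v x.
Proof.
move=> + Axv; elim=> {H x}.
- by move=> H x Hv; apply: Hv; right.
- move=> H K x y _ IHx _ IHy HKv; apply: IHy => z [Kz|->].
    by apply: HKv; right.
  by apply: IHx => t Ht; apply: HKv; left.
- move=> D T h h' /fset0Pn[a]; rewrite in_fsetI => /andP[aD aT] _ Dv.
  by exists a => //; exact: Dv.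
- move=> D1 D2 T1 T2 a h1 h1' h2 h2' h h' Hv /= Dv.
  have [|b /=] := Hv _ (or_introl erefl) => [b bD|].
    by apply: Dv; rewrite in_fsetU bD.
  rewrite in_fsetU in_fset1 => /orP[bT|/eqP-> av].
    by exists b => //; rewrite in_fsetU bT.
  have [|d /= dT dv] := Hv _ (or_intror erefl).
    move=> d; rewrite in_fsetU in_fset1 => /orP[dD|/eqP->//].
    by apply: Dv; rewrite in_fsetU dD orbT.
  by exists d => //; rewrite in_fsetU dT orbT.
- move=> a b h h' _ /(_ _ (fset11 _))[av _].
  by exists a => //; exact: fset11.
- move=> a b h h' _ /(_ _ (fset11 _))[_ bv].
  by exists b => //; exact: fset11.
- move=> a b h h' _ abv; exists (And a b); first exact: fset11.
  by split; apply: abv; rewrite /= in_fset2 eqxx ?orbT.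
- by move=> x Axx _; exact: Axv.
Qed.

Lemma i_set_itruth c (H : set (form PL)) w v :
  (forall a, H a -> truth M a w) -> acc w v -> ~ DiamondInv (truth M c) v ->
  forall x, i_set c H x -> itruth v x.
Proof.
move=> Hw wv ncv x [n [a [b [ax bx Hab]]]]; rewrite /itruth ax bx => av.
have [j|j bv] := truth_disj_fam_imp_or (Hw _ Hab) wv ncv.
  by apply: av; exact: in_imfset.
by exists (b j) => //; exact: in_imfset.
Qed.

(** Here [v] is its own successor, so the disjunction in the antecedent can be applied at [v]
    itself. *)
Lemma gamma_refl_itruth c v :
  acc v v -> ~ DiamondInv (truth M c) v ->
  forall x, gamma_refl c x -> itruth v x.
Proof.
move=> vv ncv x [n [a [b [ax bx]]]]; rewrite /itruth ax bx => av.
have [||j bv] := truth_disj_fam_imp_or (a := a) (b := b) _ vv ncv.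
- by apply: av; rewrite in_fsetU fset11 orbT.
- by move=> j; apply: av; rewrite in_fsetU in_imfset.
- by exists (b j) => //; exact: in_imfset.
Qed.

(** * Soundness of the rules beyond the basic ones *)

Hypothesis M_ps : pseudo_symmetric M.

(** [Ax] covers both logics: it is empty for [One] and [gamma_refl c] for [Two]. *)
Lemma truth_Prop c (Ax : set (iform PL)) (H : set (form PL)) w :
  (forall v, ~ DiamondInv (truth M c) v -> forall x, Ax x -> itruth v x) ->
  iderives Ax (i_set c H) (itop_bot PL) ->
  (forall a, H a -> truth M a w) -> truth M c w.
Proof.
move=> Axv der Hw; apply: truth_box_closed => v wv; apply: contrapT => ncv.
have [|a] := iderives_itruth der (Axv v ncv) (i_set_itruth Hw wv ncv).
  by move=> a; rewrite in_fset1 => /eqP->; exact: truth_Top.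
by rewrite in_fset1 => /eqP->; exact: successor_not_dead wv.
Qed.

Lemma truth_NegNegI a : truth M a `<=` truth M (Neg (Neg a)).
Proof.
move=> w aw v wv; left=> nav.
(* If [Neg a] held at [v], this [u] would be a dead end, which no successor is. *)
have [u vu au] := diamond_box_DiamondInv1 (@truth_box_closed a) aw (M_ps wv).
by case: (nav u vu) => // /(successor_not_dead M_ps vu).
Qed.

(** Unless [w] is dead, pseudo-reflexivity gives a successor satisfying [a], which [Neg a] would
    force to be a dead end. *)
Lemma truth_Abs a :
  pseudo_reflexive M -> truth M (And a (Neg a)) `<=` truth M Bot.
Proof.
move=> pr w [aw naw]; case: (pr w) => // Hw.
have [v wv av] := diamond_box_DiamondInv1 (@truth_box_closed a) aw Hw.
by case: (naw v wv) => // /(successor_not_dead M_ps wv).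
Qed.

(** This is the common core of (Refl1), applied at the given world, and (Refl2), applied at its
    successors. *)
Lemma truth_Refl w n (p a b : 'I_n -> form PL) :
  acc w w ->
  truth M (And (conj_fam (fun j => And (p j) (a j)))
               (disj_fam (fun j => Imp (a j) (b j)))) w ->
  exists j, truth M (And (p j) (b j)) w.
Proof.
move=> ww [/truth_conj_fam paw abw].
have [j|j bw] := truth_disj_fam_imp abw ww; first by case: (paw j).
by exists j; split=> //; case: (paw j).
Qed.

End Soundness.

(** * Local consequence, the relation to which the minimality of [vdash] is applied *)

Definition local_consequence (PL : Type) (k : logic) (a b : form PL) : Prop :=
  forall M : model PL, model_class k M -> truth M a `<=` truth M b.

Lemma local_consequence_basic_rules (PL : Type) (k : logic) :
  basic_rules (@local_consequence PL k).
Proof.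
have FPk M : model_class k M -> box_diamondinv_model (PL := PL) M.
  by case: k => -[].
split=> /=.
- by move=> a M _ w.
- by move=> a b c ab bc M kM w /(ab M kM)/(bc M kM).
- by move=> a M kM; exact/truth_Bot_sub/FPk.
- by move=> x a b xa xb M kM w xw; split; [exact: xa|exact: xb].
- by move=> a b M _ w [].
- by move=> a b M _ w [].
- by move=> a b M _ w aw v wv; exists w => //; left.
- by move=> a b M _ w bw v wv; exists w => //; right.
- move=> a b x ax bx M kM.
  by apply: truth_OrL; [exact: FPk|exact: ax|exact: bx].
- move=> a b ab x M kM w _ v _ /=.
  by have [/(ab M kM)|] := EM (truth M a v); [right|left].
- move=> a b c M _ w [ab ac] v wv.
  by case: (ab v wv); [left|case: (ac v wv); [left|right]].
- move=> a b c M _ w [ab bc] v wv.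
  by case: (ab v wv); [left|case: (bc v wv); [|right]].
- move=> n p a b x M kM w [abw /truth_conj_fam pbx] v wv.
  have [/truth_conj_fam pav|] :=
    EM (truth M (conj_fam (fun j => And (p j) (a j))) v); last by left.
  have [j|j bv] := truth_disj_fam_imp abw wv; first by case: (pav j).
  right; case: (pbx j v wv) => // -[]; split=> //.
  by case: (pav j).
Qed.

Lemma local_consequence_satisfies_rules (PL : Type) (k : logic) :
  satisfies_rules (@local_consequence PL k) k.
Proof.
have basic := @local_consequence_basic_rules PL k.
case: k basic => basic; split=> //.
- by move=> a M [pr ps fp]; exact: truth_Abs.
- by move=> a M [pr ps fp]; exact: truth_NegNegI.
- move=> a c der M kM w aw; case: (kM) => pr ps fp.
  by apply: (truth_Prop fp ps _ der) => // b ab; exact: ab.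
- by move=> a M [rf ps fp]; exact: truth_NegNegI.
- move=> n p a b x pbx M kM w; case: (kM) => rf ps fp.
  by move/(truth_Refl (rf w)) => [j]; exact: pbx.
- move=> n p a b x M [rf ps fp] w /truth_conj_fam pbx v wv.
  (* If the implication failed at [v], its antecedent would hold there and [x] would not. *)
  apply: contrapT => /not_orP[/contrapT/(truth_Refl (rf v))[j pbv] nxv].
  by case: (pbx j v wv).
- move=> a c der M kM w aw; case: (kM) => rf ps fp.
  apply: (truth_Prop fp ps _ der) => [v|b ab]; last exact: ab.
  exact: gamma_refl_itruth.
Qed.

Theorem theorem2 (PL : countType) (G : set (form PL)) (f : form PL) (k : logic) :
  vdash_set k G f -> entails k G f.
Proof.
move=> [G0 G0G der] M kM w Gw.
apply: (der _ (@local_consequence_satisfies_rules PL k) M kM).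
by apply/truth_conj_seq => a /G0G/Gw.
Qed.
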